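(* Let $R$ be a commutative Noetherian ring and let $\mathcal{X}$ be a resolving subcategory of $\mathrm{mod}\,R$ with $\mathcal{X}=\Omega\mathcal{X}$. Then $\mathcal{X}\subseteq\mathcal{G}(R)$.
   Context: All modules are finitely generated; $\mathrm{mod}\,R$ is the category of finitely generated $R$-modules; subcategories are full and closed under isomorphism. $(-)^*=\mathrm{Hom}_R(-,R)$. A subcategory $\mathcal{X}$ of $\mathrm{mod}\,R$ is resolving if it contains all finitely generated projective $R$-modules and is closed under direct summands, extensions, and kernels of epimorphisms. A first syzygy $\Omega M$ of $M$ is the kernel of a surjection $P\to M$ with $P$ finitely generated projective; it is unique up to projective summands. $\Omega\mathcal{X}$ is the subcategory of all modules arising as a first syzygy (for some choice of such a surjection) of a module in $\mathcal{X}$. $\mathcal{G}(R)$ is the subcategory of totally reflexive modules: those $M$ for which the natural map $M\to M^{**}$ is bijective and $\mathrm{Ext}^i_R(M,R)=\mathrm{Ext}^i_R(M^*,R)=0$ for all $i>0$. *)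

(* Defs.v *)
From HB Require Import structures.
From mathcomp Require Import all_boot all_algebra.
From mathcomp Require Import boolp.

Set Implicit Arguments.
Unset Strict Implicit.
Unset Printing Implicit Defensive.

Import GRing.Theory.
Local Open Scope ring_scope.

(** Rings are [comPzRingType]s, so the zero ring is allowed. A subcategory of
    mod [R] is a predicate on [lmodType R]. *)

Definition noetherian_ring (R : comPzRingType) : Prop :=
  forall I : R -> Prop,
    I 0 -> (forall x y, I x -> I y -> I (x + y)) ->
    (forall a x, I x -> I (a * x)) ->
  exists (n : nat) (g : 'I_n -> R),
    forall x, I x <-> exists c : 'I_n -> R, x = \sum_(i < n) c i * g i.

Definition fin_gen (R : comPzRingType) (M : lmodType R) : Prop :=
  exists (n : nat) (g : 'I_n -> M),
    forall x, exists c : 'I_n -> R, x = \sum_(i < n) c i *: g i.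

Definition surjective (A B : Type) (f : A -> B) : Prop :=
  forall y, exists x, f x = y.

Definition exact_at (R : comPzRingType) (L M N : lmodType R)
    (f : {linear L -> M}) (g : {linear M -> N}) : Prop :=
  forall y, g y = 0 <-> exists x, f x = y.

Definition short_exact (R : comPzRingType) (L M N : lmodType R)
    (f : {linear L -> M}) (g : {linear M -> N}) : Prop :=
  [/\ injective f, exact_at f g & surjective g].

Definition projective (R : comPzRingType) (P : lmodType R) : Prop :=
  forall (M N : lmodType R) (g : {linear M -> N}) (h : {linear P -> N}),
    surjective g -> exists k : {linear P -> M}, forall x, g (k x) = h x.

Definition isomorphic (R : comPzRingType) (M N : lmodType R) : Prop :=
  exists f : {linear M -> N}, bijective f.

Record subcategory (R : comPzRingType) (X : lmodType R -> Prop) : Prop := {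
  subcat_fin_gen : forall M, X M -> fin_gen M;
  subcat_iso : forall M N, isomorphic M N -> X M -> X N
}.

(** Since [X] is closed under isomorphism, the direct summands of a module in
    [X] are accounted for by the modules [M * N] in [X]. *)
Record resolving (R : comPzRingType) (X : lmodType R -> Prop) : Prop := {
  resolving_proj : forall P, fin_gen P -> projective P -> X P;
  resolving_summand : forall M N : lmodType R, X (M * N)%type -> X M;
  resolving_ext : forall (L M N : lmodType R)
    (f : {linear L -> M}) (g : {linear M -> N}),
    short_exact f g -> X L -> X N -> X M;
  resolving_ker : forall (L M N : lmodType R)
    (f : {linear L -> M}) (g : {linear M -> N}),
    short_exact f g -> X M -> X N -> X L
}.

Definition syzygies (R : comPzRingType) (X : lmodType R -> Prop) :
    lmodType R -> Prop :=
  fun K => exists (M P : lmodType R)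
    (f : {linear K -> P}) (g : {linear P -> M}),
    [/\ X M, fin_gen P, projective P & short_exact f g].

(** Linear maps as an [R]-module; the equality and choice structures on the
    type of linear maps are classical. *)
Section Hom.
Variables (R : comPzRingType) (M N : lmodType R).

Definition Hom : Type := {linear M -> N}.

Implicit Types f g h : Hom.

HB.instance Definition _ := gen_eqMixin Hom.
HB.instance Definition _ := gen_choiceMixin Hom.

Definition Hom_zero : Hom := \0.
Definition Hom_add f g : Hom := f \+ g.
Definition Hom_opp f : Hom := \- f.
Definition Hom_scale (a : R) f : Hom := a \*: f.

Lemma Hom_eq f g : f =1 g -> f = g.
Proof.
case: f => f [[cf1] [cf2]]; case: g => g [[cg1] [cg2]] /= /funext e.
case: _ / e cg1 cg2 => cg1 cg2.
by rewrite (Prop_irrelevance cf1 cg1) (Prop_irrelevance cf2 cg2).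
Qed.

Fact Hom_addA : associative Hom_add.
Proof. by move=> f g h; apply: Hom_eq => x /=; rewrite addrA. Qed.
Fact Hom_addC : commutative Hom_add.
Proof. by move=> f g; apply: Hom_eq => x /=; rewrite addrC. Qed.
Fact Hom_add0 : left_id Hom_zero Hom_add.
Proof. by move=> f; apply: Hom_eq => x /=; rewrite add0r. Qed.
Fact Hom_addN : left_inverse Hom_zero Hom_opp Hom_add.
Proof. by move=> f; apply: Hom_eq => x /=; rewrite addNr. Qed.

HB.instance Definition _ :=
  GRing.isZmodule.Build Hom Hom_addA Hom_addC Hom_add0 Hom_addN.

Fact Hom_scaleA a b f : Hom_scale a (Hom_scale b f) = Hom_scale (a * b) f.
Proof. by apply: Hom_eq => x /=; rewrite scalerA. Qed.
Fact Hom_scale1 : left_id 1 Hom_scale.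
Proof. by move=> f; apply: Hom_eq => x /=; rewrite scale1r. Qed.
Fact Hom_scaleDr : right_distributive Hom_scale +%R.
Proof. by move=> a f g; apply: Hom_eq => x /=; rewrite scalerDr. Qed.
Fact Hom_scaleDl f : {morph Hom_scale^~ f : a b / a + b}.
Proof. by move=> a b; apply: Hom_eq => x /=; rewrite scalerDl. Qed.

HB.instance Definition _ := GRing.Zmodule_isLmodule.Build R Hom
  Hom_scaleA Hom_scale1 Hom_scaleDr Hom_scaleDl.

End Hom.

Section Precomp.
Variables (R : comPzRingType) (A B N : lmodType R) (d : {linear A -> B}).

Definition precomp (f : Hom B N) : Hom A N := f \o d.

Fact precomp_is_linear : linear precomp.
Proof. by move=> a f g; apply: Hom_eq. Qed.

HB.instance Definition _ := GRing.isLinear.Build R (Hom B N) (Hom A N) _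
  precomp precomp_is_linear.

End Precomp.

Arguments precomp {R A B} N d f.

Definition dual (R : comPzRingType) (M : lmodType R) : lmodType R := Hom M R^o.

Section Biduality.
Variables (R : comPzRingType) (M : lmodType R).

Section Eval.
Variable x : M.

Definition eval_at (f : Hom M R^o) : R^o := f x.

Fact eval_at_is_linear : linear eval_at.
Proof. by []. Qed.

HB.instance Definition _ := GRing.isLinear.Build R (Hom M R^o) R^o _
  eval_at eval_at_is_linear.

End Eval.

Definition biduality (x : M) : dual (dual M) := (eval_at x : Hom (Hom M R^o) R^o).

End Biduality.

Record proj_resolution (R : comPzRingType) (M : lmodType R) := {
  pres_obj :> nat -> lmodType R;
  pres_diff : forall n, {linear pres_obj n.+1 -> pres_obj n};
  pres_aug : {linear pres_obj 0%N -> M};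
  pres_projective : forall n, projective (pres_obj n);
  pres_aug_surj : surjective pres_aug;
  pres_exact0 : exact_at (pres_diff 0%N) pres_aug;
  pres_exact : forall n, exact_at (pres_diff n.+1) (pres_diff n)
}.

(** [Ext_succ_eq0 i M N] says that Ext^[i.+1](M, N) = 0. The group is the
    cohomology in degree [i.+1] of Hom(P, N) for a projective resolution P of
    M; it depends on P only up to isomorphism. *)
Definition Ext_succ_eq0 (R : comPzRingType) (i : nat) (M N : lmodType R) : Prop :=
  exists P : proj_resolution M,
    exact_at (precomp N (pres_diff P i)) (precomp N (pres_diff P i.+1)).

Record totally_reflexive (R : comPzRingType) (M : lmodType R) : Prop := {
  totref_fin_gen : fin_gen M;
  totref_biduality : bijective (@biduality R M);
  totref_Ext : forall i, Ext_succ_eq0 i M R^o;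
  totref_Ext_dual : forall i, Ext_succ_eq0 i (dual M) R^o
}.

(* Main.v *)
Require Import Defs.
From HB Require Import structures.
From mathcomp Require Import all_boot all_algebra.
From mathcomp Require Import boolp.

Set Implicit Arguments.
Unset Strict Implicit.
Unset Printing Implicit Defensive.

Import GRing.Theory.
Local Open Scope ring_scope.

(** The heart of the matter is that Ext^1(N, R) = 0 for every N in X; total
reflexivity is then formal, because every M in X has projective resolutions on
both sides, M <- P_0 <- P_1 <- ... and M -> P^0 -> P^1 -> ..., all of whose
syzygies and cosyzygies lie in X, and the vanishing of Ext^1 on these makes
every functional on a (co)syzygy extend, so that the resolutions stay exact
under duality.

To split an extension 0 -> R -> E -> N -> 0 with N in X, note that E lies in X,
hence embeds in a finitely generated projective module G with cokernel in X. Let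
g in G be the image of 1 in R. The extension splits as soon as some functional
on G sends g to 1, i.e. as soon as the ideal I of all values at g of functionals
on G is the unit ideal. With respect to a finite dual basis of G, let xs be the
coordinates of g; they lie in I. Consider the cohomology H^k of the Koszul
complex of xs with coefficients in a module. Each coordinate of g annihilates
it, so R -> G is zero on cohomology (koszul_bound_scale). On the other hand, if
H^j(N') = 0 for all N' in X and all j < k, then the long exact sequences of
0 -> E -> G -> E1 -> 0 and 0 -> R -> E -> N -> 0 show that R -> G is injective
on H^k (koszul_bound_lift). Hence H^k(R) = 0, then H^k(P) = 0 for finitely
generated projective P, then H^k(M) = 0 for every M in X, as M is the kernel of
some P -> M1 with M1 in X. By induction all Koszul cohomology of R vanishes. In
top degree it is R modulo the ideal generated by xs, so I is the unit ideal
(regular_extension_splits).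

This is the usual argument that a proper ideal cannot have infinite grade, with
grade measured by Koszul cohomology. Arbitrary Ext^1(N, R) classes are reduced
to the above by pushing out along the functional to be extended
(functional_extends). *)

(** * Linear maps, kernels and cokernels *)

Section LinearMaps.
Variable R : comPzRingType.
Implicit Types U V W : lmodType R.

Definition mk_linear U V (f : U -> V) (lf : linear f) : {linear U -> V} :=
  HB.pack f (GRing.isLinear.Build R U V _ f lf).

Lemma linear_scale_to U (u : U) : linear (fun r : R^o => r *: u).
Proof. by move=> a x y; rewrite scalerDl scalerA. Qed.

Definition scale_to U (u : U) : {linear R^o -> U} := mk_linear (linear_scale_to u).

Lemma factor_surj U V W (p : {linear U -> V}) (f : {linear U -> W}) :
  surjective p -> (forall x, p x = 0 -> f x = 0) ->
  exists h : {linear V -> W}, forall x, h (p x) = f x.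
Proof.
move=> /choice [s sK] kpf.
have fE x y : p x = p y -> f x = f y.
  move=> e; apply: subr0_eq; rewrite -linearB; apply: kpf.
  by rewrite linearB e subrr.
have lin : linear (f \o s).
  by move=> a x y /=; rewrite -linearP; apply: fE; rewrite linearP !sK.
by exists (mk_linear lin) => x; apply: fE; rewrite sK.
Qed.

End LinearMaps.

Section Kernel.
Variables (R : comPzRingType) (U V : lmodType R) (f : {linear U -> V}).

Definition in_kernel : {pred U} := [pred x | f x == 0].

Fact in_kernel_submod_closed : submod_closed in_kernel.
Proof.
split=> [|a x y]; rewrite !inE ?raddf0 // => /eqP fx /eqP fy.
by rewrite linearP fx fy scaler0 addr0.
Qed.

HB.instance Definition _ :=
  GRing.isSubmodClosed.Build R U in_kernel in_kernel_submod_closed.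

Definition kernel := {x : U | x \in in_kernel}.

HB.instance Definition _ := [isSub of kernel for @sval _ _].
HB.instance Definition _ := [Choice of kernel by <:].
HB.instance Definition _ := [SubChoice_isSubLmodule of kernel by <:].

End Kernel.

Section Cokernel.
Variables (R : comPzRingType) (U V : lmodType R) (f : {linear U -> V}).
Local Open Scope quotient_scope.

Definition in_image : {pred V} := [pred y | `[< exists x, f x = y >]].

Fact in_image_zmod_closed : zmod_closed in_image.
Proof.
split=> [|x y]; rewrite !inE.
  by apply/asboolP; exists 0; rewrite raddf0.
move=> /asboolP [a <-] /asboolP [b <-].
by apply/asboolP; exists (a - b); rewrite raddfB.
Qed.

HB.instance Definition _ := GRing.isZmodClosed.Build V in_image in_image_zmod_closed.

Definition cokernel := Quotient.quot in_image.

HB.instance Definition _ := GRing.Zmodule.on cokernel.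
HB.instance Definition _ := EqQuotient.on cokernel.

Definition to_cokernel (y : V) : cokernel := \pi_cokernel y.

Fact to_cokernel_zmod_morphism : zmod_morphism to_cokernel.
Proof. by move=> x y; rewrite /to_cokernel !piE. Qed.

HB.instance Definition _ :=
  GRing.isZmodMorphism.Build V cokernel to_cokernel to_cokernel_zmod_morphism.

Lemma to_cokernel_eq0 y : to_cokernel y = 0 <-> exists x, f x = y.
Proof.
have -> : (exists x, f x = y) <-> y - 0 \in in_image.
  by rewrite subr0 inE; split=> /asboolP.
have pi0 : to_cokernel 0 = 0 by apply: raddf0.
by rewrite Quotient.idealrBE; split=> [e|/eqP e]; [apply/eqP|];
  apply: etrans e _.
Qed.

Lemma to_cokernel_surj : surjective to_cokernel.
Proof. by move=> q; exists (repr q); rewrite /to_cokernel reprK. Qed.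

Definition cokernel_scale (a : R) (q : cokernel) : cokernel :=
  to_cokernel (a *: repr q).

Fact cokernel_scaleE a y : cokernel_scale a (to_cokernel y) = to_cokernel (a *: y).
Proof.
apply: subr0_eq; rewrite -raddfB; apply/to_cokernel_eq0.
have [x fx] : exists x, f x = repr (to_cokernel y) - y.
  by apply/to_cokernel_eq0; rewrite raddfB /= /to_cokernel reprK subrr.
by exists (a *: x); rewrite linearZ /= fx scalerBr.
Qed.

Fact cokernel_scaleA a b q :
  cokernel_scale a (cokernel_scale b q) = cokernel_scale (a * b) q.
Proof.
by have [y <-] := to_cokernel_surj q; rewrite !cokernel_scaleE scalerA.
Qed.

Fact cokernel_scale1 : left_id 1 cokernel_scale.
Proof.
by move=> q; have [y <-] := to_cokernel_surj q; rewrite cokernel_scaleE scale1r.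
Qed.

Fact cokernel_scaleDr : right_distributive cokernel_scale +%R.
Proof.
move=> a p q; have [y <-] := to_cokernel_surj q.
have [x <-] := to_cokernel_surj p.
by rewrite -raddfD !cokernel_scaleE scalerDr raddfD.
Qed.

Fact cokernel_scaleDl q : {morph cokernel_scale^~ q : a b / a + b}.
Proof.
move=> a b; have [y <-] := to_cokernel_surj q.
by rewrite !cokernel_scaleE scalerDl raddfD.
Qed.

HB.instance Definition _ := GRing.Zmodule_isLmodule.Build R cokernel
  cokernel_scaleA cokernel_scale1 cokernel_scaleDr cokernel_scaleDl.

Fact to_cokernel_scalable : scalable to_cokernel.
Proof. by move=> a y; rewrite -cokernel_scaleE. Qed.

HB.instance Definition _ :=
  GRing.isScalable.Build R V cokernel _ to_cokernel to_cokernel_scalable.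

End Cokernel.

Section KernelCokernelExistence.
Variable R : comPzRingType.
Implicit Types U V : lmodType R.

Lemma kernel_exists U V (f : {linear U -> V}) :
  exists (K : lmodType R) (i : {linear K -> U}), injective i /\ exact_at i f.
Proof.
exists (kernel f), (\val : {linear kernel f -> U}); split; first exact: val_inj.
move=> y; split=> [fy|[x <-]]; last exact/eqP/(valP x).
by have ky : y \in in_kernel f by [apply/eqP]; exists (Sub y ky).
Qed.

Lemma cokernel_exists U V (f : {linear U -> V}) :
  exists (Q : lmodType R) (p : {linear V -> Q}), exact_at f p /\ surjective p.
Proof.
exists (cokernel f), (to_cokernel f : {linear V -> cokernel f}).
by split; [exact: to_cokernel_eq0 | exact: to_cokernel_surj].
Qed.

End KernelCokernelExistence.

(** * The Koszul complex *)

Section Koszul.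
Variable R : comPzRingType.
Implicit Types (xs : seq R) (L M N : lmodType R).

(** The cochain complex as an iterated mapping cone: adding the element x to the
sequence replaces a complex by the cone of multiplication by x. All degrees are
lumped together in one module, and [homog] recovers the grading. *)
Fixpoint koszul xs N : lmodType R :=
  if xs is _ :: xs' then (koszul xs' N * koszul xs' N)%type else N.

Fixpoint koszul_diff xs N : koszul xs N -> koszul xs N :=
  if xs is x :: xs' then
    fun z => (koszul_diff z.1, x *: z.1 - koszul_diff z.2)
  else fun _ => 0.

Fact koszul_diff_linear xs N : linear (@koszul_diff xs N).
Proof.
elim: xs => [|x xs IH] /= a u v; first by rewrite scaler0 addr0.
congr pair; rewrite /= !IH //.
by rewrite scalerDr scalerBr opprD addrACA !scalerA mulrC.
Qed.

HB.instance Definition _ xs N := GRing.isLinear.Build R _ _ _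
  (@koszul_diff xs N) (@koszul_diff_linear xs N).

Lemma koszul_diffK xs N (z : koszul xs N) : koszul_diff (koszul_diff z) = 0.
Proof.
elim: xs z => [|x xs IH] //= z.
by rewrite IH linearB linearZ /= IH subr0 subrr.
Qed.

Fixpoint koszul_map xs M N (f : M -> N) : koszul xs M -> koszul xs N :=
  if xs is _ :: xs' then fun z => (koszul_map f z.1, koszul_map f z.2) else f.

Fact koszul_map_linear xs M N (f : {linear M -> N}) :
  linear (@koszul_map xs M N f).
Proof.
elim: xs => [|x xs IH] /= a u v; first by rewrite linearP.
by rewrite !IH.
Qed.

HB.instance Definition _ xs M N (f : {linear M -> N}) :=
  GRing.isLinear.Build R _ _ _ (@koszul_map xs M N f) (koszul_map_linear f).

Lemma koszul_map_diff xs M N (f : {linear M -> N}) (z : koszul xs M) :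
  koszul_map f (koszul_diff z) = koszul_diff (koszul_map f z).
Proof.
elim: xs z => [|x xs IH] z /=; first by rewrite raddf0.
by rewrite linearB linearZ /= !IH.
Qed.

(** [homog k] is homogeneity of degree k - 1. The shift makes [homog 0] mean being
zero, the right convention in degree -1, so that truncated predecessors do no
harm. *)
Fixpoint homog xs N k : koszul xs N -> Prop :=
  if xs is _ :: xs' then fun z => homog k z.1 /\ homog k.-1 z.2
  else fun z => k = 1%N \/ z = 0.

Lemma homog0 xs N k : homog k (0 : koszul xs N).
Proof. by elim: xs k => [|x xs IH] k /=; [right | split]. Qed.

Lemma homog_deg0 xs N (z : koszul xs N) : homog 0 z -> z = 0.
Proof.
elim: xs z => [|x xs IH] z /=; first by case.
by case: z => a b /= [/IH -> /IH ->].
Qed.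

Lemma homogP xs N k a (u v : koszul xs N) :
  homog k u -> homog k v -> homog k (a *: u + v).
Proof.
elim: xs k u v => [|x xs IH] k u v /=.
  by case=> [-> | ->]; [left | case=> [|->]; [left | right; rewrite scaler0 addr0]].
by move=> [u1 u2] [v1 v2]; split; apply: IH.
Qed.

Lemma homogZ xs N k a (u : koszul xs N) : homog k u -> homog k (a *: u).
Proof. by move=> hu; rewrite -[_ *: _]addr0; apply: homogP => //; apply: homog0. Qed.

Lemma homogB xs N k (u v : koszul xs N) :
  homog k u -> homog k v -> homog k (u - v).
Proof. by move=> hu hv; rewrite addrC -scaleN1r; apply: homogP. Qed.

Lemma homog_sum xs N k n (z : 'I_n -> koszul xs N) :
  (forall i, homog k (z i)) -> homog k (\sum_(i < n) z i).
Proof.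
move=> hz; elim/big_ind: _ => [|u v hu hv|i _] //; first exact: homog0.
by rewrite -[u]scale1r; apply: homogP.
Qed.

Lemma homog_diff xs N k (z : koszul xs N) : homog k.-1 z -> homog k (koszul_diff z).
Proof.
elim: xs k z => [|x xs IH] k z /=; first by right.
move=> [z1 z2]; split; first exact: IH.
by apply: homogB; [apply: homogZ | apply: IH].
Qed.

Lemma homog_map xs M N (f : {linear M -> N}) k (z : koszul xs M) :
  homog k z -> homog k (koszul_map f z).
Proof.
elim: xs k z => [|x xs IH] k z /=.
  by case=> [->|->]; [left | right; rewrite raddf0].
by move=> [z1 z2]; split; apply: IH.
Qed.

Lemma koszul_map_inj xs M N (f : {linear M -> N}) :
  injective f -> injective (@koszul_map xs M N f).
Proof.
move=> fI; elim: xs => [|x xs IH] //= [a b] [c d] /= e.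
by rewrite (IH _ _ (congr1 fst e)) (IH _ _ (congr1 snd e)).
Qed.

Lemma koszul_map_surj xs M N (f : {linear M -> N}) k (z : koszul xs N) :
  surjective f -> homog k z -> exists2 w, homog k w & koszul_map f w = z.
Proof.
move=> fS; elim: xs k z => [|x xs IH] k z /=.
  case=> [->|->]; last by exists 0; [right | rewrite raddf0].
  by have [w fw] := fS z; exists w; first left.
case: z => a b /= [/IH [u hu <-] /IH [v hv <-]].
by exists (u, v).
Qed.

Lemma koszul_map_exact xs L M N (f : {linear L -> M}) (g : {linear M -> N}) k
    (z : koszul xs M) :
  exact_at f g -> homog k z -> koszul_map g z = 0 ->
  exists2 w, homog k w & koszul_map f w = z.
Proof.
move=> fg; elim: xs k z => [|x xs IH] k z /=.
  case=> [->|->]; last by exists 0; [right | rewrite raddf0].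
  by move=> /fg [w fw]; exists w; first left.
case: z => a b /= [ha hb] e.
have [u hu <-] := IH _ _ ha (congr1 fst e).
have [v hv <-] := IH _ _ hb (congr1 snd e).
by exists (u, v).
Qed.

Lemma koszul_map_comp xs L M N (f : {linear L -> M}) (g : {linear M -> N})
    (z : koszul xs L) :
  koszul_map (g \o f) z = koszul_map g (koszul_map f z).
Proof. by elim: xs z => [|x xs IH] z //=; rewrite !IH. Qed.

Lemma koszul_map_comp_scale xs M N (f : {linear M -> N}) (g : {linear N -> M}) c
    (z : koszul xs M) :
  (forall x, g (f x) = c *: x) -> koszul_map g (koszul_map f z) = c *: z.
Proof. by move=> e; elim: xs z => [|x xs IH] z //=; rewrite !IH. Qed.

Lemma koszul_map_comp0 xs L M N (f : {linear L -> M}) (g : {linear M -> N})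
    (z : koszul xs L) :
  (forall x, g (f x) = 0) -> koszul_map g (koszul_map f z) = 0.
Proof. by move=> e; elim: xs z => [|x xs IH] z //=; rewrite !IH. Qed.

Lemma koszul_map_sum xs M N n (f : 'I_n -> {linear M -> N})
    (g : 'I_n -> {linear N -> M}) (z : koszul xs M) :
  (forall x, x = \sum_(i < n) g i (f i x)) ->
  z = \sum_(i < n) koszul_map (g i) (koszul_map (f i) z).
Proof.
move=> e; elim: xs z => [|x xs IH] z //=.
rewrite [LHS]surjective_pairing [RHS]surjective_pairing !raddf_sum /=.
by rewrite -!IH.
Qed.

(** On the cone of multiplication by c, moving the second summand into the first is
a homotopy between multiplication by c and zero; and a homotopy for the tail of
the sequence extends to the cone, with a sign on the second summand. *)
Lemma koszul_homotopy xs N c : c \in xs ->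
  exists s : {linear koszul xs N -> koszul xs N},
    (forall k z, homog k.+1 z -> homog k (s z)) /\
    (forall z, koszul_diff (s z) + s (koszul_diff z) = c *: z).
Proof.
elim: xs => [|x xs IH] //=; rewrite inE => /orP [/eqP ->|/IH [s [sh sd]]].
  have lin : linear (fun z : (koszul xs N * koszul xs N)%type =>
      (z.2, 0) : (koszul xs N * koszul xs N)%type).
    by move=> a u v; apply: injective_projections; rewrite /= ?scaler0 ?addr0.
  exists (mk_linear lin); split=> [k z [_ h2]|[a b]] /=.
    by split=> //; apply: homog0.
  apply: injective_projections; rewrite /= ?raddf0 ?subr0 ?addr0 //.
  by rewrite addrC subrK.
have lin : linear (fun z : (koszul xs N * koszul xs N)%type =>
    (s z.1, - s z.2) : (koszul xs N * koszul xs N)%type).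
  move=> a u v.
  by apply: injective_projections; rewrite /= linearP ?opprD ?scalerN.
exists (mk_linear lin); split=> [k z [h1 h2]|[a b]] /=.
  split; first exact: sh.
  case: k h2 {h1} => [/homog_deg0 -> | k /sh h2].
    by rewrite raddf0 oppr0; apply: homog0.
  by rewrite -[- _]add0r; apply: homogB => //; apply: homog0.
apply: injective_projections; rewrite //= linearB linearZ /= raddfN opprK opprB.
by rewrite [X in X + _]addrC addrACA subrr addr0 sd.
Qed.

End Koszul.

(** * Koszul cohomology *)

Section KoszulCohomology.
Variable R : comPzRingType.
Implicit Types (xs : seq R) (L M N : lmodType R).

Definition koszul_bound xs N k (z : koszul xs N) : Prop :=
  exists2 h, homog k h & koszul_diff h = z.

(** Because of the shift in [homog], this says that the cohomology in degree k - 1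
is zero; for k = 0 it is void. *)
Definition koszul_vanish xs k N : Prop :=
  forall z : koszul xs N, homog k z -> koszul_diff z = 0 -> koszul_bound k.-1 z.

Lemma koszul_vanish0 xs N : koszul_vanish xs 0 N.
Proof.
move=> z /homog_deg0 -> _; exists 0; first exact: homog0.
exact: raddf0.
Qed.

(** The connecting map of the long exact sequence: a class z that dies in M comes
from the cohomology of N one degree below, which vanishes. *)
Lemma koszul_bound_lift xs k L M N (f : {linear L -> M}) (g : {linear M -> N})
    (z : koszul xs L) :
  short_exact f g -> koszul_vanish xs k N ->
  koszul_bound k (koszul_map f z) -> koszul_bound k z.
Proof.
move=> [fI fg gS] vN [h hh dh].
have gh0 : koszul_diff (koszul_map g h) = 0.
  rewrite -koszul_map_diff dh; apply: koszul_map_comp0 => x.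
  by apply/fg; exists x.
have [h' hh' dh'] := vN _ (homog_map g hh) gh0.
have [h'' hh'' gh''] := koszul_map_surj gS hh'.
have hB : homog k (h - koszul_diff h'') by apply: homogB (homog_diff hh'').
have gB : koszul_map g (h - koszul_diff h'') = 0.
  by rewrite linearB /= koszul_map_diff gh'' dh' subrr.
have [w hw fw] := koszul_map_exact fg hB gB.
exists w => //; apply: (koszul_map_inj fI).
by rewrite koszul_map_diff fw linearB /= koszul_diffK subr0.
Qed.

Lemma koszul_vanish_shift xs k L M N (f : {linear L -> M}) (g : {linear M -> N}) :
  short_exact f g -> koszul_vanish xs k N -> koszul_vanish xs k.+1 M ->
  koszul_vanish xs k.+1 L.
Proof.
move=> ex vN vM z hz dz; apply: koszul_bound_lift ex vN _.
by apply: vM; [exact: homog_map | rewrite -koszul_map_diff dz raddf0].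
Qed.

Lemma koszul_bound_scale xs k N (z : koszul xs N) c :
  c \in xs -> homog k.+1 z -> koszul_diff z = 0 -> koszul_bound k (c *: z).
Proof.
move=> /(koszul_homotopy N) [s [sh sd]] hz dz.
exists (s z); first exact: sh.
by rewrite -sd dz raddf0 addr0.
Qed.

(** Finitely generated projective modules are used through finite dual bases,
because these reduce cohomology to the coefficient ring and pass to the dual
module by exchanging vectors and functionals. *)
Definition dual_basis M n (e : 'I_n -> M) (f : 'I_n -> {linear M -> R^o}) : Prop :=
  forall x, x = \sum_(i < n) f i x *: e i.

(** The coordinate functionals make M a direct summand of a power of R, hence the
cohomology of M a direct summand of a power of that of R. *)
Lemma koszul_bound_dual_basis xs k M n (e : 'I_n -> M) f (z : koszul xs M) :
  dual_basis e f -> (forall i, koszul_bound k (koszul_map (f i) z)) ->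
  koszul_bound k z.
Proof.
move=> ef /fin_all_exists2 [h hh dh].
exists (\sum_(i < n) koszul_map (scale_to (e i)) (h i)).
  by apply: homog_sum => i; apply: homog_map.
rewrite raddf_sum [RHS](koszul_map_sum (f := f) (g := fun i => scale_to (e i))) //.
by apply: eq_bigr => i _; rewrite -dh koszul_map_diff.
Qed.

Lemma koszul_vanish_dual_basis xs k M n (e : 'I_n -> M) f :
  dual_basis e f -> koszul_vanish xs k R^o -> koszul_vanish xs k M.
Proof.
move=> ef vR z hz dz; apply: koszul_bound_dual_basis ef _ => i.
by apply: vR; [exact: homog_map | rewrite -koszul_map_diff dz raddf0].
Qed.

(** The component in the top degree, the number of elements of the sequence, where
the complex is a single copy of the coefficients. *)
Fixpoint koszul_top xs : koszul xs R^o -> R :=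
  if xs is _ :: xs' then fun z => koszul_top z.2 else id.

Fact koszul_top_linear xs : linear (@koszul_top xs : _ -> R^o).
Proof. by elim: xs => [|x xs IH] a u v //=; apply: IH. Qed.

HB.instance Definition _ xs :=
  GRing.isLinear.Build R _ R^o _ (@koszul_top xs) (@koszul_top_linear xs).

Fixpoint koszul_unit xs : koszul xs R^o :=
  if xs is _ :: xs' then (0, koszul_unit xs') else 1.

Lemma homog_koszul_unit xs : homog (size xs).+1 (koszul_unit xs).
Proof.
elim: xs => [|x xs IH] /=; first by left.
by split; first exact: homog0.
Qed.

Lemma koszul_diff_unit xs : koszul_diff (koszul_unit xs) = 0.
Proof. by elim: xs => [|x xs IH] //=; rewrite IH raddf0 scaler0 subr0. Qed.

Lemma koszul_top_unit xs : koszul_top (koszul_unit xs) = 1.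
Proof. by elim: xs. Qed.

(** Into the top degree the differential is, up to signs, the row of the elements of
the sequence; so top coboundaries lie in the ideal that they generate. *)
Lemma koszul_top_diff (I : R -> Prop) xs (z : koszul xs R^o) :
  I 0 -> (forall a u v, I u -> I v -> I (a * u - v)) ->
  (forall x, x \in xs -> I x) -> I (koszul_top (koszul_diff z)).
Proof.
move=> I0 IP; elim: xs z => [|x xs IH] //= z Ixs.
rewrite linearB linearZ /= {1}/GRing.scale /= mulrC; apply: IP.
  by apply: Ixs; rewrite inE eqxx.
by apply: IH => y ys; apply: Ixs; rewrite inE ys orbT.
Qed.

End KoszulCohomology.

(** * Dual bases of finitely generated projective modules *)

Section DualBasis.
Variable R : comPzRingType.
Implicit Types M N P : lmodType R.

Lemma dual_basis_projective M n (e : 'I_n -> M) f :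
  dual_basis e f -> projective M.
Proof.
move=> ef A B g h gS.
have [m gm] := fin_all_exists (fun i => gS (h (e i))).
have lin : linear (fun x => \sum_(i < n) f i x *: m i).
  move=> a x y; rewrite scaler_sumr -big_split; apply: eq_bigr => i _ /=.
  by rewrite linearP scalerDl scalerA.
exists (mk_linear lin) => x /=; rewrite [in RHS](ef x) !linear_sum.
by apply: eq_bigr => i _; rewrite /= !linearZ /= gm.
Qed.

Lemma dual_basis_fin_gen M n (e : 'I_n -> M) f : dual_basis e f -> fin_gen M.
Proof. by move=> ef; exists n, e => x; exists (fun i => f i x). Qed.

Fact coord_linear n (i : 'I_n) : linear (fun v : 'rV[R]_n => v 0 i : R^o).
Proof. by move=> a u v; rewrite !mxE. Qed.

Lemma row_dual_basis n : dual_basis (fun i : 'I_n => delta_mx 0 i : 'rV[R]_n)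
  (fun i => mk_linear (@coord_linear n i)).
Proof. by move=> v; apply: row_sum_delta. Qed.

Lemma fin_gen_cover M : fin_gen M ->
  exists n (p : {linear 'rV[R]_n -> M}), surjective p.
Proof.
move=> [n [g gP]]; exists n.
have lin : linear (fun v : 'rV[R]_n => \sum_(i < n) v 0 i *: g i).
  move=> a u v; rewrite scaler_sumr -big_split; apply: eq_bigr => i _ /=.
  by rewrite !mxE scalerDl scalerA.
exists (mk_linear lin) => x; have [c ->] := gP x.
by exists (\row_i c i); apply: eq_bigr => i _; rewrite mxE.
Qed.

Lemma projective_dual_basis M : fin_gen M -> projective M ->
  exists n (e : 'I_n -> M) f, dual_basis e f.
Proof.
move=> /fin_gen_cover [n [p pS]] /(_ _ _ p (idfun : {linear M -> M}) pS) [s ps].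
exists n, (fun i => p (delta_mx 0 i)), (fun i => mk_linear (@coord_linear n i) \o s).
move=> x; rewrite -[LHS]ps [in LHS](row_dual_basis (s x)) linear_sum.
by apply: eq_bigr => i _; rewrite linearZ.
Qed.

End DualBasis.

(** * Exactness of spliced sequences under duality *)

Section ExactSplicing.
Variable R : comPzRingType.
Implicit Types A B C D L M P : lmodType R.

Lemma exact_at_comp_surj A B C L (q : {linear L -> A}) (a : {linear A -> B})
    (b : {linear B -> C}) :
  surjective q -> exact_at a b -> exact_at (a \o q) b.
Proof.
move=> qS ab y; split=> [/ab [x <-]|[x <-]]; last by apply/ab; exists (q x).
by have [z <-] := qS x; exists z.
Qed.

Lemma exact_at_comp_inj A B C D (a : {linear A -> B}) (b : {linear B -> C})
    (c : {linear C -> D}) :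
  injective c -> exact_at a b -> exact_at a (c \o b).
Proof.
move=> cI ab y; split=> [cb0|/ab e]; last by rewrite /= e raddf0.
by apply/ab; apply: cI; rewrite raddf0.
Qed.

(** A functional killed by d factors through C, and then has to be extended from C
to D: here the vanishing of Ext^1 of the cokernel of c enters. *)
Lemma dual_exact_at A B C D (d : {linear A -> B}) (b : {linear B -> C})
    (c : {linear C -> D}) :
  exact_at d b -> surjective b ->
  (forall f : {linear C -> R^o},
    exists F : {linear D -> R^o}, forall x, F (c x) = f x) ->
  exact_at (precomp R^o (c \o b)) (precomp R^o d).
Proof.
move=> db bS ext h; split=> [hd0|[F <-]].
  have [f fE] : exists f : {linear C -> R^o}, forall x, f (b x) = h x.
    apply: factor_surj bS _ => _ /db [x <-].
    exact: (congr1 (eval_at x) hd0).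
  by have [F FE] := ext f; exists F; apply: Hom_eq => x /=; rewrite FE fE.
apply: Hom_eq => x /=; have -> : b (d x) = 0 by apply/db; exists x.
by rewrite !raddf0.
Qed.

Definition torsionless M : Prop :=
  forall x : M, (forall u : {linear M -> R^o}, u x = 0) -> x = 0.

Definition biduality_surjective M : Prop :=
  forall phi : {linear dual M -> R^o}, exists x : M, forall u, phi u = u x.

(** Over reflexive modules double dualization changes nothing: an element of the
double dual of B is evaluation at some y, and if it dies in the double dual of C
then all functionals on C vanish at d' y, so that y comes from A. *)
Lemma bidual_exact_at A B C (d : {linear A -> B}) (d' : {linear B -> C}) :
  exact_at d d' -> biduality_surjective B -> torsionless C ->
  exact_at (precomp R^o (precomp R^o d)) (precomp R^o (precomp R^o d')).
Proof.
move=> dd' refB tlC phi; split=> [phi0|[psi <-]].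
  have [y yE] := refB phi.
  have /dd' [x xy] : d' y = 0.
    apply: tlC => u; rewrite -[LHS](yE (precomp R^o d' u)).
    exact: (congr1 (eval_at (u : dual C)) phi0).
  exists (biduality x); apply: Hom_eq => u /=.
  by rewrite yE -xy.
apply: Hom_eq => u /=; rewrite -[RHS](raddf0 psi); congr (psi _).
apply: Hom_eq => x /=; have -> : d' (d x) = 0 by apply/dd'; exists x.
exact: raddf0.
Qed.

Lemma dual_basis_torsionless M n (e : 'I_n -> M) f : dual_basis e f -> torsionless M.
Proof. by move=> ef x ux0; rewrite (ef x) big1 // => i _; rewrite ux0 scale0r. Qed.

Lemma dual_dual_basis M n (e : 'I_n -> M) f : dual_basis e f ->
  dual_basis (f : 'I_n -> dual M) (fun i => eval_at (e i)).
Proof.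
move=> ef u; apply: Hom_eq => x.
rewrite -[RHS]/(eval_at x _) (raddf_sum (eval_at x)) (ef x) raddf_sum.
apply: eq_bigr => i _; rewrite /= /eval_at /= -(ef x).
by rewrite linearZ /= /GRing.scale /= mulrC.
Qed.

Lemma dual_basis_biduality_surjective M n (e : 'I_n -> M) f :
  dual_basis e f -> biduality_surjective M.
Proof.
move=> ef phi; exists (\sum_(i < n) phi (f i) *: e i) => u.
rewrite {1}(dual_dual_basis ef u) !linear_sum.
by apply: eq_bigr => i _; rewrite !linearZ /= /GRing.scale /= mulrC.
Qed.

End ExactSplicing.

(** * Resolving subcategories closed under cosyzygies *)

Section StableResolving.
Variables (R : comPzRingType) (X : lmodType R -> Prop).
Hypothesis hres : resolving X.
Hypothesis hsub : subcategory X.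
Hypothesis hsyz : forall M : lmodType R, X M -> syzygies X M.
Implicit Types E L M N P : lmodType R.

Lemma resolving_regular : X R^o.
Proof.
have bas : dual_basis (fun _ : 'I_1 => 1 : R^o)
    (fun _ => idfun : {linear R^o -> R^o}).
  by move=> x; rewrite big_ord1 /= /GRing.scale /= mulr1.
apply: (resolving_proj hres); first exact: dual_basis_fin_gen bas.
exact: dual_basis_projective bas.
Qed.

(** An infinite-grade argument: the coordinates [xs] of the image [g] of 1 in a
projective module G containing E generate the unit ideal, since the Koszul
cohomology on [xs] of every module in X vanishes. *)
Lemma regular_extension_splits E N (phi : {linear R^o -> E}) (psi : {linear E -> N}) :
  short_exact phi psi -> X N -> exists r : {linear E -> R^o}, r (phi 1) = 1.
Proof.
move=> ex XN.
have XE : X E := resolving_ext hres ex resolving_regular XN.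
have [E1 [G [j [q [XE1 fgG prG exG]]]]] := hsyz XE.
have [n [e [f ef]]] := projective_dual_basis fgG prG.
pose g := j (phi 1).
pose xs := [seq f i g | i <- enum 'I_n] : seq R.
have van k : forall M, X M -> koszul_vanish xs k M.
  elim: k => [|k IH] M XM; first exact: koszul_vanish0.
  (* By induction it suffices that the class z dies in G; it does so because its
     i-th coordinate there is z multiplied by the element f i g of xs. *)
  have vR : koszul_vanish xs k.+1 R^o.
    move=> z hz dz; apply: koszul_bound_lift ex (IH _ XN) _.
    apply: koszul_bound_lift exG (IH _ XE1) _.
    apply: koszul_bound_dual_basis ef _ => i.
    have jz : forall r : R^o, (f i \o j) (phi r) = (f i g : R) *: r.
      move=> r; rewrite -[r in LHS]mulr1 -[r * 1]/(r *: (1 : R^o)) /= !linearZ /=.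
      by rewrite -/g /GRing.scale /= mulrC.
    have -> : koszul_map (f i) (koszul_map j (koszul_map phi z)) = (f i g : R) *: z.
      by rewrite -koszul_map_comp; apply: koszul_map_comp_scale jz.
    apply: koszul_bound_scale hz dz.
    by apply/mapP; exists i; rewrite // mem_enum.
  have [M1 [P [i [p [XM1 fgP prP exM]]]]] := hsyz XM.
  have [m [e' [f' ef']]] := projective_dual_basis fgP prP.
  apply: koszul_vanish_shift exM (IH _ XM1) _.
  exact: koszul_vanish_dual_basis ef' vR.
have [h _ dh] := van _ _ resolving_regular _
  (homog_koszul_unit xs) (koszul_diff_unit xs).
have [l lg] : exists l : {linear G -> R^o}, l g = 1.
  rewrite -(koszul_top_unit xs) -dh.
  apply: (koszul_top_diff (I := fun r => exists l : {linear G -> R^o}, l g = r)).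
  - by exists (\0 : {linear G -> R^o}).
  - by move=> a _ _ [u <-] [v <-]; exists ((a \*: u) \- v : {linear G -> R^o}).
  - by move=> _ /mapP [i _ ->]; exists (f i).
by exists (l \o j).
Qed.

(** In other words Ext^1(N, R) = 0. The pushout E of M along f is an extension of N
by R; a retraction of E onto R, composed with M -> E, extends f. *)
Lemma functional_extends L M N (i : {linear L -> M}) (p : {linear M -> N})
    (f : {linear L -> R^o}) :
  short_exact i p -> X N -> exists F : {linear M -> R^o}, forall x, F (i x) = f x.
Proof.
move=> [iI ip pS] XN.
(* The pushout is the cokernel of x |-> (i x, - f x). *)
have lu : linear (fun x => (i x, - f x) : (M * R^o)%type).
  move=> a x y; rewrite !linearP.
  by apply: injective_projections; rewrite /= ?opprD ?scalerN.
have [E [w [uw wS]]] := cokernel_exists (mk_linear lu).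
have lin_l : linear (fun x : M => (x, 0) : (M * R^o)%type).
  by move=> a x y; apply: injective_projections; rewrite //= scaler0 addr0.
have lin_r : linear (fun r : R^o => (0, r) : (M * R^o)%type).
  by move=> a x y; apply: injective_projections; rewrite //= scaler0 addr0.
pose inl := mk_linear lin_l; pose inr := mk_linear lin_r.
have pw0 (y : (M * R^o)%type) : w y = 0 -> (p \o fst) y = 0.
  by move=> /uw [x <-] /=; apply/ip; exists x.
have [psi psiE] := factor_surj (f := p \o fst : {linear (M * R^o)%type -> N}) wS pw0.
have [r rE] : exists r : {linear E -> R^o}, r ((w \o inr) 1) = 1.
  apply: (regular_extension_splits (psi := psi)) XN; split.
  - apply: raddf_inj => a /= /uw [x /=] [ix0 <-].
    by have -> : x = 0; [apply: iI; rewrite ix0 raddf0 | rewrite raddf0 oppr0].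
  - move=> y; split=> [|[a <-]]; last by rewrite /= psiE /= raddf0.
    have [[b a] <-] := wS y; rewrite psiE /= => /ip [x /= <-].
    exists (a + f x); apply: subr0_eq; rewrite /= -linearB; apply/uw.
    exists (- x); rewrite /= (raddfN i) (raddfN f) opprK.
    by apply: injective_projections; rewrite /= ?sub0r // addrC addKr.
  - move=> y; have [b <-] := pS y.
    by exists (w (b, 0)); rewrite psiE.
exists (r \o w \o inl) => x /=.
have -> : w (i x, 0) = w (0, f x).
  apply: subr0_eq; rewrite -linearB; apply/uw; exists x.
  by apply: injective_projections; rewrite /= ?subr0 ?sub0r.
have -> : (0, f x) = f x *: inr 1.
  by apply: injective_projections; rewrite /= ?scaler0 // /GRing.scale /= mulr1.
by rewrite !linearZ /= rE /GRing.scale /= mulr1.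
Qed.

(** Bundling modules with membership in X makes the choice of a syzygy or a
cosyzygy an endofunction, which can be iterated. *)
Definition Xobj := {M : lmodType R | X M}.

Lemma Xobj_syzygies : exists (next : Xobj -> Xobj) (P : Xobj -> lmodType R)
    (i : forall s : Xobj, {linear sval (next s) -> P s})
    (q : forall s : Xobj, {linear P s -> sval s}),
  forall s : Xobj, [/\ fin_gen (P s), projective (P s) & short_exact (i s) (q s)].
Proof.
suff /all_tag [next /all_tag [P /all_tag [i /all_sig [q H]]]] :
    forall s : Xobj, {t : Xobj & {P : lmodType R &
      {i : {linear sval t -> P} & {q : {linear P -> sval s} |
        [/\ fin_gen P, projective P & short_exact i q]}}}}.
  by exists next, P, i, q.
case=> M XM; have /cid [n /cid [p pS]] := fin_gen_cover (subcat_fin_gen hsub XM).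
have bas := @row_dual_basis R n.
have fgP := dual_basis_fin_gen bas; have prP := dual_basis_projective bas.
have /cid [K /cid [i [iI ip]]] := kernel_exists p.
have ex : short_exact i p by [].
exists (exist X K (resolving_ker hres ex (resolving_proj hres fgP prP) XM)).
by exists 'rV[R]_n, i, p.
Qed.

Lemma Xobj_cosyzygies : exists (next : Xobj -> Xobj) (P : Xobj -> lmodType R)
    (i : forall s : Xobj, {linear sval s -> P s})
    (q : forall s : Xobj, {linear P s -> sval (next s)}),
  forall s : Xobj, [/\ fin_gen (P s), projective (P s) & short_exact (i s) (q s)].
Proof.
suff /all_tag [next /all_tag [P /all_tag [i /all_sig [q H]]]] :
    forall s : Xobj, {t : Xobj & {P : lmodType R &
      {i : {linear sval s -> P} & {q : {linear P -> sval t} |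
        [/\ fin_gen P, projective P & short_exact i q]}}}}.
  by exists next, P, i, q.
case=> M XM.
have /cid [N /cid [P /cid [i /cid [q [XN fgP prP ex]]]]] := hsyz XM.
by exists (exist X N XN), P, i, q.
Qed.

Lemma Ext_regular_eq0 M k : X M -> Ext_succ_eq0 k M R^o.
Proof.
move=> XM; have [next [P [i [q H]]]] := Xobj_syzygies.
pose s n := iter n next (exist X M XM).
pose d n : {linear P (s n.+1) -> P (s n)} := i (s n) \o q (s n.+1).
have prP n : projective (P (s n)) by have [] := H (s n).
have qS n : surjective (q (s n)) by have [_ _ []] := H (s n).
have iI n : injective (i (s n)) by have [_ _ []] := H (s n).
have dq n : exact_at (d n) (q (s n)).
  by apply: exact_at_comp_surj (qS _) _; have [_ _ []] := H (s n).
have dd n : exact_at (d n.+1) (d n) by apply: exact_at_comp_inj.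
exists (@Build_proj_resolution R M (P \o s) d (q (s 0)) prP (qS 0) (dq 0) dd).
apply: dual_exact_at (dq _) (qS _) _ => f.
by have [_ _ ex] := H (s k); apply: functional_extends ex (svalP (s k)).
Qed.

Lemma X_torsionless M : X M -> torsionless M.
Proof.
move=> XM x ux0; have [N [P [i [q [_ fgP prP [iI _ _]]]]]] := hsyz XM.
have [n [e [f ef]]] := projective_dual_basis fgP prP.
apply: iI; rewrite raddf0; apply: (dual_basis_torsionless ef) => u.
exact: (ux0 (u \o i)).
Qed.

(** With 0 -> M -> P -> N -> 0 exact and N in X, a functional phi on the dual of M
induces one on the dual of P, which is evaluation at some y in P. Functionals
that come from N vanish at y, and N is torsionless, so y lies in M. All
functionals on M extend to P, hence phi is evaluation at y. *)
Lemma X_biduality_surjective M : X M -> biduality_surjective M.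
Proof.
move=> XM phi; have [N [P [i [q [XN fgP prP ex]]]]] := hsyz XM.
have [n [e [f ef]]] := projective_dual_basis fgP prP.
have [y yE] := dual_basis_biduality_surjective ef (phi \o precomp R^o i).
have [_ iq _] := ex.
have /iq [x xy] : q y = 0.
  apply: (X_torsionless XN) => u; rewrite -[LHS](yE (u \o q)) /=.
  rewrite -[RHS](raddf0 phi); congr (phi _); apply: Hom_eq => x /=.
  by have -> : q (i x) = 0 by [apply/iq; exists x]; apply: raddf0.
exists x => u; have [F Fu] := functional_extends u ex XN.
have -> : u = precomp R^o i F by apply: Hom_eq => z; rewrite -Fu.
by apply: etrans (yE F) _; rewrite -xy.
Qed.

(** The dual of the coresolution of M is a projective resolution of the dual of M,
and dualizing once more gives back the coresolution, which is exact. *)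
Lemma Ext_dual_regular_eq0 M k : X M -> Ext_succ_eq0 k (dual M) R^o.
Proof.
move=> XM; have [next [P [i [q H]]]] := Xobj_cosyzygies.
pose s n := iter n next (exist X M XM).
pose d n : {linear P (s n) -> P (s n.+1)} := i (s n.+1) \o q (s n).
have bas n : exists m (e : 'I_m -> P (s n)) f, dual_basis e f.
  by have [fgP prP _] := H (s n); apply: projective_dual_basis.
have qS n : surjective (q (s n)) by have [_ _ []] := H (s n).
have iI n : injective (i (s n)) by have [_ _ []] := H (s n).
have iq n : exact_at (i (s n)) (q (s n)) by have [_ _ []] := H (s n).
have ext n (f : {linear sval (s n) -> R^o}) :
    exists F : {linear P (s n) -> R^o}, forall x, F (i (s n) x) = f x.
  have [_ _ ex] := H (s n).
  exact: functional_extends f ex (svalP (s n.+1)).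
have dq n : exact_at (d n) (q (s n.+1)) by apply: exact_at_comp_surj.
have dd n : exact_at (d n) (d n.+1) by apply: exact_at_comp_inj.
have prD n : projective (dual (P (s n))).
  have [m [e [f ef]]] := bas n.
  exact: dual_basis_projective (dual_dual_basis ef).
have augS : surjective (precomp R^o (i (s 0)) : {linear dual (P (s 0)) -> dual M}).
  by move=> f; have [F Ff] := ext 0 f; exists F; apply: Hom_eq.
have aug0 : exact_at (precomp R^o (d 0)) (precomp R^o (i (s 0))).
  exact: dual_exact_at (iq 0) (qS 0) (ext 1).
have ddD n : exact_at (precomp R^o (d n.+1)) (precomp R^o (d n)).
  exact: dual_exact_at (dq n) (qS n.+1) (ext n.+2).
exists (@Build_proj_resolution R (dual M) (fun n => dual (P (s n)))
  (fun n => precomp R^o (d n)) (precomp R^o (i (s 0))) prD augS aug0 ddD).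
have [m [e [f ef]]] := bas k.+1; have [m' [e' [f' ef']]] := bas k.+2.
apply: bidual_exact_at (dd k) _ _.
  exact: dual_basis_biduality_surjective ef.
exact: dual_basis_torsionless ef'.
Qed.

Lemma X_totally_reflexive M : X M -> totally_reflexive M.
Proof.
move=> XM; split=> [||k|k].
- exact: subcat_fin_gen hsub _ XM.
- have bI : injective (@biduality R M).
    move=> x y e; apply: subr0_eq; apply: (X_torsionless XM) => u.
    rewrite linearB; apply/eqP; rewrite subr_eq0; apply/eqP.
    exact: (congr1 (eval_at (u : dual M)) e).
  have /choice [g gE] : forall phi, exists x : M, biduality x = phi.
    move=> phi; have [x xE] := X_biduality_surjective XM phi.
    by exists x; apply: Hom_eq => u; rewrite xE.
  by exists g => [x|phi]; [apply: bI|]; rewrite gE.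
- exact: Ext_regular_eq0.
- exact: Ext_dual_regular_eq0.
Qed.

End StableResolving.

Theorem theorem4p3 (R : comPzRingType) (hR : noetherian_ring R)
    (X : lmodType R -> Prop) (hsub : subcategory X) (hres : resolving X)
    (hsyz : forall M : lmodType R, X M <-> syzygies X M) :
  forall M : lmodType R, X M -> totally_reflexive M.
Proof.
by move=> M; apply: X_totally_reflexive => // N /hsyz.
Qed.
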